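(* Let $T$ be a $J$-self-adjoint operator. Assume that $T_{\min}$ is densely defined in $H$ and $n_+ (T_{\min}) = n_- (T_{\min}) =: m < \infty$. Then: (i) $m$ is even and $n_+ (T_{\min}^+) = n_- (T_{\min}^+) = n_+ (T_{\min}^-) = n_- (T_{\min}^-) = m/2$. (ii) Let $\{ \mathbb C^{m/2}, \Gamma_0^+ , \Gamma_1^+\}$ be a boundary triple for $T_{\max}^+ $. Then there exists a boundary triple $\{ \mathbb C^{m/2}, \Gamma_0^- , \Gamma_1^- \}$ for $T_{\max}^- $ such that \[ \operatorname{dom}(T) = \{h \in \mathcal{D}_{\max}: \ \Gamma_0^+ P_+ h =\Gamma_0^- P_- h, \ \Gamma_1^+ P_+ h =\Gamma_1^- P_- h \}. \]
   Context: $J=J^*=J^{-1}$ is a signature operator in a Hilbert space $H$, $H_\pm=\ker(J\mp I)$, $P_\pm$ the orthogonal projections onto $H_\pm$. $T$ is $J$-self-adjoint ($JT$ self-adjoint), $T_{\min}:=T\cap T^*$, $\mathcal D_{\min}=\operatorname{dom}(T_{\min})$, $T_{\min}^\pm:=T\upharpoonright(\mathcal D_{\min}\cap H_\pm)$ (symmetric operators in $H_\pm$ with $T_{\min}=T_{\min}^+\oplus T_{\min}^-$), $T_{\max}^\pm:=(T_{\min}^\pm)^*$, $\mathcal D_{\max}^\pm:=\operatorname{dom}(T_{\max}^\pm)$, $\mathcal D_{\max}:=\mathcal D_{\max}^+\oplus\mathcal D_{\max}^-$. $n_\pm$ denote deficiency indices. A boundary triple $\{\mathcal H,\Gamma_0,\Gamma_1\}$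 for $S^*$ ($S$ closed densely defined symmetric) consists of a Hilbert space $\mathcal H$ and linear maps $\Gamma_j:\operatorname{dom}(S^* )\to\mathcal H$ with $(S^*f,g)-(f,S^*g)=(\Gamma_1f,\Gamma_0g)_{\mathcal H}-(\Gamma_0f,\Gamma_1g)_{\mathcal H}$ for all $f,g\in\operatorname{dom}(S^* )$ and $f\mapsto\{\Gamma_0f,\Gamma_1f\}$ surjective onto $\mathcal H\oplus\mathcal H$. *)

(* Defs.v *)
(* complex scalars R[i] over R : realType (mathcomp-real-closed complex). *)
From HB Require Import structures.
From mathcomp Require Import all_boot all_order all_algebra all_reals complex.
Set Implicit Arguments. Unset Strict Implicit. Unset Printing Implicit Defensive.
Import Order.TTheory GRing.Theory Num.Theory.
Local Open Scope ring_scope.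

Section HilbertDefs.
Variable R : realType.
Variable H : lmodType R[i].
Variable ip : H -> H -> R[i].   (* inner product, linear in the 1st argument *)

(* norm induced by the inner product *)
Definition hnorm (x : H) : R := Num.sqrt (complex.Re (ip x x)).

(* ip is an inner product and H is complete: H is a complex Hilbert space *)
Definition is_hilbert : Prop :=
  [/\ (forall (a : R[i]) (x y z : H), ip (a *: x + y) z = a * ip x z + ip y z),
      (forall x y : H, ip y x = (ip x y)^*),
      (forall x : H, 0 <= ip x x),
      (forall x : H, ip x x = 0 -> x = 0) &
      (forall u : nat -> H,
         (forall e : R, 0 < e -> exists N : nat, forall n m : nat,
             (N <= n)%N -> (N <= m)%N -> hnorm (u n - u m) < e) ->
         exists x : H, forall e : R, 0 < e -> exists N : nat, forall n : nat,
             (N <= n)%N -> hnorm (u n - x) < e)].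

(* D is dense in K (both subsets of H) *)
Definition dense_in (K D : H -> Prop) : Prop :=
  forall x, K x -> forall e : R, 0 < e -> exists y, D y /\ K y /\ hnorm (x - y) < e.

(* linear relations (graphs of operators) in H *)
Definition lrel := H * H -> Prop.
Definition dom (S : lrel) : H -> Prop := fun f => exists g, S (f, g).
Definition linear_rel (S : lrel) : Prop :=
  S (0, 0) /\ forall (a : R[i]) p q, S p -> S q -> S (a *: p.1 + q.1, a *: p.2 + q.2).
Definition single_valued (S : lrel) : Prop :=
  forall f g g', S (f, g) -> S (f, g') -> g = g'.
Definition rel_inter (S S' : lrel) : lrel := fun p => S p /\ S' p.

(* adjoint of S taken in the (closed) subspace K of H;
   adj_in (fun _ => True) S is the usual adjoint S^* in H *)
Definition adj_in (K : H -> Prop) (S : lrel) : lrel :=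
  fun p => [/\ K p.1, K p.2 & forall q, S q -> ip q.2 p.1 = ip q.1 p.2].
Definition adj (S : lrel) : lrel := adj_in (fun _ => True) S.

Definition self_adjoint (S : lrel) : Prop :=
  dense_in (fun _ => True) (dom S) /\ S = adj S.

(* the operator J T *)
Definition Jrel (J : H -> H) (T : lrel) : lrel :=
  fun p => exists g, T (p.1, g) /\ p.2 = J g.

Definition J_self_adjoint (J : H -> H) (T : lrel) : Prop := self_adjoint (Jrel J T).

(* H_+ = ker (J - I), H_- = ker (J + I) *)
Definition Hplus (J : H -> H) : H -> Prop := fun f => J f - f = 0.
Definition Hminus (J : H -> H) : H -> Prop := fun f => J f + f = 0.

(* orthogonal projections onto H_+ and H_- *)
Definition Pplus (J : H -> H) (x : H) : H := 2^-1 *: (x + J x).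
Definition Pminus (J : H -> H) (x : H) : H := 2^-1 *: (x - J x).

Definition Tmin (T : lrel) : lrel := rel_inter T (adj T).
(* T_min^{+-} := T restricted to D_min \cap H_{+-} *)
Definition Tmin_plus (J : H -> H) (T : lrel) : lrel :=
  fun p => Tmin T p /\ Hplus J p.1.
Definition Tmin_minus (J : H -> H) (T : lrel) : lrel :=
  fun p => Tmin T p /\ Hminus J p.1.
(* T_max^{+-} := adjoint of T_min^{+-} in H_{+-} *)
Definition Tmax_plus (J : H -> H) (T : lrel) : lrel := adj_in (Hplus J) (Tmin_plus J T).
Definition Tmax_minus (J : H -> H) (T : lrel) : lrel := adj_in (Hminus J) (Tmin_minus J T).
(* D_max = D_max^+ (+) D_max^- *)
Definition Dmax (J : H -> H) (T : lrel) : H -> Prop :=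
  fun h => exists f g, [/\ dom (Tmax_plus J T) f, dom (Tmax_minus J T) g & h = f + g].

(* the subspace V of H has (finite) dimension n *)
Definition has_dim (V : H -> Prop) (n : nat) : Prop :=
  exists v : 'I_n -> H,
    [/\ forall j, V (v j),
        (forall c : 'I_n -> R[i], \sum_(j < n) c j *: v j = 0 -> forall j, c j = 0) &
        forall x, V x -> exists c : 'I_n -> R[i], x = \sum_(j < n) c j *: v j].

(* deficiency spaces of S in K: ker (S^* -+ i) with S^* the adjoint in K *)
Definition defect_plus (K : H -> Prop) (S : lrel) : H -> Prop :=
  fun f => adj_in K S (f, 'i *: f).
Definition defect_minus (K : H -> Prop) (S : lrel) : H -> Prop :=
  fun f => adj_in K S (f, - 'i *: f).
(* n_+(S) = n and n_-(S) = n', computed in the space K *)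
Definition n_plus_is (K : H -> Prop) (S : lrel) (n : nat) : Prop := has_dim (defect_plus K S) n.
Definition n_minus_is (K : H -> Prop) (S : lrel) (n : nat) : Prop := has_dim (defect_minus K S) n.

(* standard inner product on C^k *)
Definition cdot (k : nat) (x y : 'cV[R[i]]_k) : R[i] := \sum_(j < k) x j 0 * (y j 0)^*.

(* {C^k, G0, G1} is a boundary triple for S^*, S^* being the adjoint of S in K *)
Definition boundary_triple (K : H -> Prop) (S : lrel) (k : nat)
    (G0 G1 : H -> 'cV[R[i]]_k) : Prop :=
  let Sa := adj_in K S in
  [/\ (forall (a : R[i]) f g, dom Sa f -> dom Sa g ->
          G0 (a *: f + g) = a *: G0 f + G0 g /\ G1 (a *: f + g) = a *: G1 f + G1 g),
      (forall p q, Sa p -> Sa q ->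
          ip p.2 q.1 - ip p.1 q.2 = cdot (G1 p.1) (G0 q.1) - cdot (G0 p.1) (G1 q.1)) &
      (forall a b : 'cV[R[i]]_k, exists f, [/\ dom Sa f, G0 f = a & G1 f = b])].

End HilbertDefs.

(* Main.v *)
(** With [A = J T] self-adjoint one has [T^* = J T J], so [Tmin] is [J]-invariant
    and [T] is maximal isotropic for the form [<J T f, g> - <J f, T g>] on
    [dom Tmax].  By von Neumann's formula [Tmax = Tmin + N_i + N_{-i}], so modulo
    [Tmin] this is linear algebra in a space of dimension [2m], where the image
    [L] of [dom T] has dimension at least [m].  [L] meets trivially each
    [N_i(s) + N_{-i}(s')], with [s, s'] signs and [N_c(s)] the part of [N_c] where
    [J = s]: for [s' = s] because [T] and [T^*] agree on [H_s]; for [s' = -s] because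
    there [T h = i s J h], which contradicts the symmetry of [J T].  Counting
    dimensions gives (i), and also that [L] is complementary to
    [N_i(s) + N_{-i}(s)], i.e. [P_{-s}] maps [dom T] onto [Dmax^{-s}].  For (ii),
    put [G^-(P_- h) := G^+(P_+ h)] for [h] in [dom T]. *)
Require Import Defs.
From HB Require Import structures.
From mathcomp Require Import all_boot all_order all_algebra all_reals complex.
From mathcomp Require Import boolp classical_sets ring lra zify.
Set Implicit Arguments. Unset Strict Implicit. Unset Printing Implicit Defensive.
Import Order.TTheory GRing.Theory Num.Theory.
Local Open Scope ring_scope.

(** * Orthogonal projections *)

Section InnerProduct.
Variables (R : realType) (H : lmodType R[i]) (ip : H -> H -> R[i]).
Hypothesis hilb : is_hilbert ip.

Lemma ipDl x y z : ip (x + y) z = ip x z + ip y z.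
Proof. by case: hilb => + _ _ _ _ => /(_ 1 x y z); rewrite scale1r mul1r. Qed.

Lemma ip0l z : ip 0 z = 0.
Proof. by apply: (addrI (ip 0 z)); rewrite -ipDl !addr0. Qed.

Lemma ipZl a x z : ip (a *: x) z = a * ip x z.
Proof. by case: hilb => + _ _ _ _ => /(_ a x 0 z); rewrite !addr0 ip0l addr0. Qed.

Lemma ipC x y : ip y x = (ip x y)^*.
Proof. by case: hilb. Qed.

Lemma ipNl x z : ip (- x) z = - ip x z.
Proof. by rewrite -scaleN1r ipZl mulN1r. Qed.

Lemma ipDr x y z : ip z (x + y) = ip z x + ip z y.
Proof. by rewrite ipC ipDl rmorphD /= -!ipC. Qed.

Lemma ip0r z : ip z 0 = 0.
Proof. by rewrite ipC ip0l rmorph0. Qed.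

Lemma ipZr a x z : ip z (a *: x) = a^* * ip z x.
Proof. by rewrite ipC ipZl rmorphM /= -ipC. Qed.

Lemma ipNr x z : ip z (- x) = - ip z x.
Proof. by rewrite ipC ipNl rmorphN /= -ipC. Qed.

Definition ipE := (ipDl, ipDr, ipNl, ipNr, ipZl, ipZr, ip0l, ip0r).

Lemma ip_eq0 x : ip x x = 0 -> x = 0.
Proof. by case: hilb => _ _ _ + _; apply. Qed.

(** The real form is used wherever order matters: minimization, Cauchy-Schwarz and limits take place
    in [R]. *)
Definition rip x y := complex.Re (ip x y).

Lemma ReD (u v : R[i]) : complex.Re (u + v) = complex.Re u + complex.Re v.
Proof. by case: u v => [a b] [c d]. Qed.

Lemma ripDl x y z : rip (x + y) z = rip x z + rip y z.
Proof. by rewrite /rip ipDl ReD. Qed.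

Lemma ripC x y : rip x y = rip y x.
Proof. by rewrite /rip (ipC y x); case: (ip y x). Qed.

Lemma ripDr x y z : rip z (x + y) = rip z x + rip z y.
Proof. by rewrite ripC ripDl !(ripC _ z). Qed.

Lemma ripNl x z : rip (- x) z = - rip x z.
Proof. by rewrite /rip ipNl; case: (ip x z). Qed.

Lemma ripNr x z : rip z (- x) = - rip z x.
Proof. by rewrite ripC ripNl ripC. Qed.

Lemma ripZl (a : R) x z : rip (a%:C%C *: x) z = a * rip x z.
Proof. by rewrite /rip ipZl; case: (ip x z) => c d /=; rewrite mul0r subr0. Qed.

Lemma ripZr (a : R) x z : rip z (a%:C%C *: x) = a * rip z x.
Proof. by rewrite ripC ripZl ripC. Qed.

Definition ripE := (ripDl, ripDr, ripNl, ripNr, ripZl, ripZr).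

Lemma rip_ge0 x : 0 <= rip x x.
Proof.
case: hilb => _ _ /(_ x) + _ _; rewrite /rip; case: (ip x x) => a b.
by rewrite lecE /= => /andP[].
Qed.

Lemma hnorm_lt x (e : R) : 0 < e -> (hnorm ip x < e) = (rip x x < e ^+ 2).
Proof.
move=> e0; have {1}-> : e = Num.sqrt (e ^+ 2) by rewrite sqrtr_sqr gtr0_norm.
by rewrite /hnorm ltr_sqrt // exprn_gt0.
Qed.

Lemma ip_eq0_rip x y : (forall a, rip (a *: x) y = 0) -> ip x y = 0.
Proof.
(* This multiplier turns the real part into the squared modulus of [ip x y]. *)
move=> /(_ (ip x y)^*%C); rewrite /rip ipZl; case: (ip x y) => a b /=.
rewrite mulNr opprK -!expr2 => /eqP; rewrite paddr_eq0 ?sqr_ge0 //.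
by rewrite !sqrf_eq0 => /andP[/eqP-> /eqP->].
Qed.

End InnerProduct.

(** Evaluation at the minimizer [l = r / q]. If [q = 0] the expression is affine in [l], and a
    nonzero [r] makes it negative at [(e + 1) / r]. *)
Lemma quadratic_ge0 (R : realFieldType) (e r q : R) : 0 <= q ->
  (forall l, 0 <= e - 2 * (l * r) + l ^+ 2 * q) -> r ^+ 2 <= e * q.
Proof.
move=> q0 h; have [q00|qn0] := eqVneq q 0.
  rewrite q00 mulr0; have [->|rn0] := eqVneq r 0; first by rewrite expr0n.
  have := h ((e + 1) / r); rewrite q00 divfK // mulr0 => h1.
  by have := h 0; rewrite q00; lra.
have qp : 0 < q by rewrite lt_neqAle eq_sym qn0.
have := h (r / q).
have -> : e - 2 * (r / q * r) + (r / q) ^+ 2 * q = (e * q - r ^+ 2) / q by field.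
by rewrite pmulr_lge0 ?invr_gt0 // subr_ge0.
Qed.

Lemma sqr_le_small (R : realFieldType) (r q : R) : 0 <= q ->
  (forall d, 0 < d -> r ^+ 2 <= d * q) -> r = 0.
Proof.
move=> q0 h; apply/eqP/negPn/negP => rn0.
have r2 : 0 < r ^+ 2 by rewrite lt_neqAle sqr_ge0 eq_sym expf_neq0.
have q1 : 0 < q + 1 by lra.
have := h _ (divr_gt0 r2 q1); rewrite mulrAC ler_pdivlMr //; lra.
Qed.

(** From [(a + b) ^+ 2 <= 2 * (a ^+ 2 + b ^+ 2)], which explains the quarters. *)
Lemma sqrD_le (R : realFieldType) (a b q e1 e2 d : R) : 0 <= q ->
  a ^+ 2 <= e1 * q -> b ^+ 2 <= e2 * q -> e1 < d / 4 -> e2 < d / 4 -> (a + b) ^+ 2 <= d * q.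
Proof.
move=> q0 ha hb h1 h2.
have : e1 * q <= d / 4 * q by rewrite ler_wpM2r // ltW.
have : e2 * q <= d / 4 * q by rewrite ler_wpM2r // ltW.
have := sqr_ge0 (a - b); rewrite sqrrB sqrrD; lra.
Qed.

Section Projection.
Variables (R : realType) (H : lmodType R[i]) (ip : H -> H -> R[i]).
Hypothesis hilb : is_hilbert ip.
Local Notation rip := (rip ip).

(** Closed subspaces are represented as orthogonal complements of arbitrary sets, so that linearity
    and closedness come for free. *)
Definition orth (X : H -> Prop) : H -> Prop := fun x => forall y, X y -> ip y x = 0.

Lemma orth_lin X a x y : orth X x -> orth X y -> orth X (a *: x + y).
Proof. by move=> hx hy z Xz; rewrite !(ipE hilb) hx // hy // mulr0 addr0. Qed.

Lemma orth0 X : orth X 0.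
Proof. by move=> z _; rewrite (ipE hilb). Qed.

Lemma rip_expand x y (l : R) :
  rip (x - l%:C%C *: y) (x - l%:C%C *: y) = rip x x - 2 * (l * rip x y) + l ^+ 2 * rip y y.
Proof. rewrite !(ripE hilb) (ripC hilb y x); ring. Qed.

Lemma rip_cauchy_schwarz x y : rip x y ^+ 2 <= rip x x * rip y y.
Proof.
apply: quadratic_ge0 => [|l]; first exact: rip_ge0.
by rewrite -rip_expand; apply: rip_ge0.
Qed.

(* A minimizing sequence [s n] is almost orthogonal to [M := orth X]; taking
   [t := s n - s k] as test vector shows that it is Cauchy. *)
Lemma orth_projection X v :
  exists s, orth X s /\ forall t, orth X t -> ip t (v - s) = 0.
Proof.
set E : set R := [set r | exists2 t, orth X t & r = rip (v - t) (v - t)]%classic.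
have lbE : lbound E 0 by move=> _ [t _ ->]; apply: rip_ge0.
have hE : has_inf E.
  by split; [exists (rip (v - 0) (v - 0)), 0 => //; exact: orth0|exists 0].
pose eps n : R := n.+1%:R^-1.
have eps0 n : 0 < eps n by rewrite invr_gt0 ltr0Sn.
have /choice[s hs] n : exists t, orth X t /\ rip (v - t) (v - t) < inf E + eps n.
  by have [_ [t Xt ->] lt_e] := inf_adherent (eps0 n) hE; exists t.
(* [s n] is minimal up to [eps n]; comparing it with [s n + l t] gives a quadratic in [l] that is
   never negative. *)
have almost n t : orth X t -> rip (v - s n) t ^+ 2 <= eps n * rip t t.
  move=> Xt; have [Xs lt_s] := hs n.
  apply: quadratic_ge0 => [|l]; first exact: rip_ge0.
  have : inf E <= rip (v - s n - l%:C%C *: t) (v - s n - l%:C%C *: t).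
    apply: ge_inf; first by exists 0.
    exists (l%:C%C *: t + s n); first exact: orth_lin.
    by rewrite opprD addrA addrAC.
  by rewrite rip_expand; lra.
have epsN (e : R) : 0 < e -> exists N, forall n, (N <= n)%N -> eps n < e.
  move=> e0; exists (Num.bound e^-1) => n le_n.
  rewrite -[e]invrK ltf_pV2 ?posrE ?invr_gt0 ?ltr0Sn //.
  apply: lt_le_trans (archi_boundP _) _; first by rewrite invr_ge0 ltW.
  by rewrite ler_nat (leq_trans le_n).
have [s0 cvg_s] : exists s0, forall e, 0 < e -> exists N, forall n,
    (N <= n)%N -> hnorm ip (s n - s0) < e.
  have [_ _ _ _] := hilb; apply => e e0.
  (* The factor 4 is consumed by [sqrD_le]; the factor 2 leaves [q <= e ^+ 2 / 2], hence a strict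
     bound, after division by [q]. *)
  have [|N hN] := epsN (e ^+ 2 / 2 / 4); first by rewrite !divr_gt0 ?exprn_gt0.
  exists N => n k le_n le_k; rewrite hnorm_lt //.
  have Xt : orth X (s n - s k).
    by rewrite addrC -scaleN1r; apply: orth_lin; apply: (hs _).1.
  have : rip (s n - s k) (s n - s k) =
      rip (v - s k) (s n - s k) - rip (v - s n) (s n - s k).
    by rewrite -(ripNl hilb) -(ripDl hilb) opprB [in RHS]addrC addrA subrK.
  move=> q_eq; have lt_n := hN n le_n; have lt_k := hN k le_k.
  have := almost n _ Xt; rewrite -sqrrN => le1.
  have := sqrD_le (rip_ge0 hilb _) (almost k _ Xt) le1 lt_k lt_n.
  have e20 : 0 < e ^+ 2 by rewrite exprn_gt0.
  rewrite -q_eq; move: (rip_ge0 hilb (s n - s k)); move: (rip _ _) => q q0.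
  have [->//|qn0] := eqVneq q 0; rewrite expr2 ler_pM2r; first by lra.
  by rewrite lt_neqAle eq_sym qn0.
have cvg_sq e : 0 < e -> exists N, forall n, (N <= n)%N -> rip (s n - s0) (s n - s0) < e.
  move=> e0; have [|N hN] := cvg_s (Num.sqrt e); first by rewrite sqrtr_gt0.
  exists N => n /hN; rewrite hnorm_lt ?sqrtr_gt0 // sqr_sqrtr //; exact: ltW.
(* Both properties pass to the limit by Cauchy-Schwarz: the real pairings are squeezed below every
   [d]. *)
exists s0; split=> [y Xy|t Xt]; apply: (ip_eq0_rip hilb) => a.
  apply: (sqr_le_small (rip_ge0 hilb (a *: y))) => d d0.
  have [N /(_ N (leqnn N)) hN] := cvg_sq d d0.
  have -> : rip (a *: y) s0 = - rip (s N - s0) (a *: y).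
    rewrite (ripDl hilb) (ripNl hilb) opprD opprK !(ripC hilb _ (a *: y)).
    by rewrite [X in - X]/(complex.Re _) (ipZl hilb) ((hs N).1 y Xy) mulr0 oppr0 add0r.
  rewrite sqrrN; apply: le_trans (rip_cauchy_schwarz _ _) _.
  by rewrite ler_wpM2r ?(rip_ge0 hilb) // ltW.
have Xt' : orth X (a *: t) by rewrite -[_ *: _]addr0; apply: orth_lin Xt _; apply: orth0.
move: (a *: t) Xt' => {}t {}Xt.
apply: (sqr_le_small (rip_ge0 hilb t)) => d d0.
have [|N hN] := cvg_sq (d / 4); first lra.
have [|N' hN'] := epsN (d / 4); first lra.
pose n := maxn N N'.
have -> : rip t (v - s0) = rip (v - s n) t + rip (s n - s0) t.
  by rewrite -(ripDl hilb) addrA subrK (ripC hilb).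
apply: (sqrD_le (rip_ge0 hilb t) (almost n t Xt) (rip_cauchy_schwarz _ _)).
  exact: hN' (leq_maxr _ _).
exact: hN (leq_maxl _ _).
Qed.

End Projection.

(** * The Hilbert space of pairs, in which graphs live *)

Section Product.
Variables (R : realType) (H : lmodType R[i]) (ip : H -> H -> R[i]).
Hypothesis hilb : is_hilbert ip.

Definition ip2 (p q : H * H) : R[i] := ip p.1 q.1 + ip p.2 q.2.

Lemma is_hilbert_ip2 : is_hilbert ip2.
Proof.
have rip2E p : rip ip2 p p = rip ip p.1 p.1 + rip ip p.2 p.2 by rewrite /rip ReD.
have hn2 p e : 0 < e -> hnorm ip2 p < e -> hnorm ip p.1 < e /\ hnorm ip p.2 < e.
  move=> e0; rewrite !hnorm_lt // rip2E => h.
  by have := rip_ge0 hilb p.1; have := rip_ge0 hilb p.2; split; lra.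
split.
- by move=> a x y z; rewrite /ip2 /= !(ipE hilb); ring.
- by move=> x y; rewrite /ip2 (ipC hilb x.1) (ipC hilb x.2) rmorphD.
- move=> x; have [_ _ pos _ _] := hilb.
  by rewrite /ip2 addr_ge0.
- have [_ _ pos _ _] := hilb.
  case=> x y /eqP; rewrite /ip2 paddr_eq0 ?pos //= => /andP[/eqP x0 /eqP y0].
  by rewrite (ip_eq0 hilb x0) (ip_eq0 hilb y0).
move=> u cu; have [_ _ _ _ cmpl] := hilb.
have [|x hx] := cmpl (fun n => (u n).1).
  move=> e e0; have [N hN] := cu e e0.
  by exists N => n k le_n le_k; have [] := hn2 _ _ e0 (hN n k le_n le_k).
have [|y hy] := cmpl (fun n => (u n).2).
  move=> e e0; have [N hN] := cu e e0.
  by exists N => n k le_n le_k; have [] := hn2 _ _ e0 (hN n k le_n le_k).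
exists (x, y) => e e0; have e2 : 0 < e / 2 by lra.
have [N hN] := hx _ e2; have [N' hN'] := hy _ e2.
exists (maxn N N') => n; rewrite geq_max => /andP[/hN + /hN'].
rewrite !hnorm_lt // rip2E /=.
have := exprn_gt0 2 e0; have -> : (e / 2) ^+ 2 = e ^+ 2 / 4 by field.
lra.
Qed.

End Product.

(** * Coordinates and dimension *)

Section RowSpaces.
Variables (F : fieldType) (n : nat).

(** Take [U] of maximal rank among matrices with row space inside [P]; a vector of [P] outside that
    row space could be adjoined and would raise the rank. *)
Lemma subspace_mx (P : 'rV[F]_n -> Prop) :
  P 0 -> (forall a x y, P x -> P y -> P (a *: x + y)) ->
  exists U : 'M_n, forall x, P x <-> (x <= U)%MS.
Proof.
move=> P0 Plin.
pose Q k := `[< exists2 U : 'M[F]_n, \rank U = k & forall x : 'rV_n, (x <= U)%MS -> P x >].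
have exQ : exists k, Q k.
  exists 0%N; apply/asboolP; exists 0; first exact: mxrank0.
  by move=> x; rewrite submx0 => /eqP->.
have ubQ k : Q k -> (k <= n)%N by move=> /asboolP[U <- _]; exact: rank_leq_row.
case: (ex_maxnP exQ ubQ) => k /asboolP[U rU UP] maxk.
exists U => x; split=> [Px|]; last exact: UP.
have sUUx : (U <= U + x)%MS := addsmxSl U x.
have : (\rank (U + x)%MS <= \rank U)%N.
  rewrite rU; apply: maxk; apply/asboolP; exists (U + x)%MS => // y /sub_addsmxP[[a b] /= ->].
  by rewrite [b]mx11_scalar mul_scalar_mx addrC; apply: Plin => //; apply/UP/submxMl.
by rewrite (geq_leqif (mxrank_leqif_sup sUUx)) addsmx_sub => /andP[].
Qed.

Lemma mxrank_direct3 (Y Z L : 'M[F]_n) :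
  (forall y z : 'rV_n, (y <= Y)%MS -> (z <= Z)%MS -> ((y + z)%R <= L)%MS -> y = 0 /\ z = 0) ->
  \rank (Y + Z + L)%MS = (\rank Y + \rank Z + \rank L)%N.
Proof.
move=> dir; rewrite mxrank_disjoint_sum.
  congr (_ + _)%N; apply: mxrank_disjoint_sum; apply/eqP; rewrite -submx0.
  apply/row_subP => i; have := row_sub i (Y :&: Z)%MS.
  rewrite sub_capmx => /andP[iY iZ].
  (* Since [0] lies in [L], a common row of [Y] and [Z], taken with its negative, must vanish. *)
  have [|||-> _] := dir (row i (Y :&: Z)%MS) (- row i (Y :&: Z)%MS) => //.
  - by rewrite -scaleN1r scalemx_sub.
  - by rewrite subrr sub0mx.
  - exact: sub0mx.
apply/eqP; rewrite -submx0; apply/row_subP => i.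
have := row_sub i ((Y + Z)%MS :&: L)%MS.
rewrite sub_capmx => /andP[/sub_addsmxP[[a b] /= ->] iL].
have [|||-> ->] := dir (a *m Y) (b *m Z) => //; rewrite ?submxMl //.
by rewrite addr0 sub0mx.
Qed.

End RowSpaces.

Section LinearCombination.
Variables (F : fieldType) (V : lmodType F).

Definition lincomb n (v : 'I_n -> V) (x : 'rV[F]_n) : V := \sum_j x 0 j *: v j.

Lemma lincomb_is_linear n (v : 'I_n -> V) : linear (lincomb v).
Proof.
move=> a x y; rewrite /lincomb scaler_sumr -big_split; apply: eq_bigr => j _.
by rewrite !mxE scalerDl scalerA.
Qed.

HB.instance Definition _ n (v : 'I_n -> V) :=
  GRing.isLinear.Build F 'rV[F]_n V _ (lincomb v) (lincomb_is_linear v).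

Lemma lincomb_row_mx n1 n2 (v : 'I_n1 -> V) (w : 'I_n2 -> V) x y :
  lincomb (fun j => match split j with inl i => v i | inr i => w i end) (row_mx x y) =
  lincomb v x + lincomb w y.
Proof.
rewrite /lincomb big_split_ord; congr (_ + _); apply: eq_bigr => i _.
  by rewrite row_mxEl (unsplitK (inl i)).
by rewrite row_mxEr (unsplitK (inr i)).
Qed.

Lemma linear_mulmx n k (f : {linear 'rV[F]_n -> V}) (c : 'rV_k) (B : 'M_(k, n)) :
  f (c *m B) = \sum_j c 0 j *: f (row j B).
Proof. by rewrite mulmx_sum_row linear_sum; apply: eq_bigr => j _; rewrite linearZ. Qed.

End LinearCombination.

(** * Dimensions of subspaces as matrix ranks *)

Section Dimension.
Variables (R : realType) (H : lmodType R[i]) (n : nat) (f : {linear 'rV[R[i]]_n -> H}).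
Hypothesis f_inj : forall x, f x = 0 -> x = 0.
Variables (P : H -> Prop) (U : 'M[R[i]]_n).
Hypothesis f_surj : forall h, P h -> exists x, h = f x.
Hypothesis PU : forall x, P (f x) <-> (x <= U)%MS.

Lemma has_dim_mxrank : has_dim P (\rank U).
Proof.
exists (fun j => f (row j (row_base U))); split.
- by move=> j; apply/PU; rewrite (submx_trans (row_sub _ _)) ?eq_row_base.
- move=> c c0 j; pose cr : 'rV_(\rank U) := \row_j c j.
  have /f_inj/eqP : f (cr *m row_base U) = 0.
    by rewrite linear_mulmx -[RHS]c0; apply: eq_bigr => i _; rewrite mxE.
  rewrite mulmx_free_eq0 ?row_base_free // => /eqP/matrixP/(_ 0 j).
  by rewrite !mxE.
move=> h Ph; have [x hx] := f_surj Ph.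
move: Ph; rewrite hx => /PU; rewrite -(eq_row_base U) => /submxP[c ->].
by exists (c 0); rewrite linear_mulmx.
Qed.

(** Pulling the basis of [P] back along [f] gives a row-free matrix with the same row space as
    [U]. *)
Lemma mxrank_has_dim k : has_dim P k -> \rank U = k.
Proof.
move=> [v [Pv free_v span_v]].
have /fin_all_exists[x vx] j : exists x, v j = f x by apply/f_surj/Pv.
pose X : 'M_(k, n) := \matrix_j x j.
have fX (c : 'rV_k) : f (c *m X) = \sum_j c 0 j *: v j.
  by rewrite linear_mulmx; apply: eq_bigr => j _; rewrite rowK vx.
have freeX : row_free X.
  apply: inj_row_free => c cX0; apply/rowP => j; rewrite mxE.
  by apply: free_v j; rewrite -fX cX0 linear0.
rewrite -(eqP freeX); apply/eqP; rewrite eqn_leq; apply/andP; split; apply: mxrankS.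
  apply/row_subP => i; have [c hc] := span_v _ ((PU _).2 (row_sub i U)).
  have /f_inj/eqP : f (row i U - (\row_j c j) *m X) = 0.
    by rewrite linearB /= fX hc; apply/eqP; rewrite subr_eq0; apply/eqP/eq_bigr => j _; rewrite mxE.
  by rewrite subr_eq0 => /eqP->; apply: submxMl.
by apply/row_subP => i; rewrite rowK; apply/PU; rewrite -vx.
Qed.

End Dimension.

Lemma half_double (R : realType) (V : lmodType R[i]) (f : V) : 2^-1 *: (f + f) = f.
Proof.
have -> : f + f = (2 : R[i]) *: f by rewrite scaler_nat mulr2n.
by rewrite scalerA mulVf ?scale1r // pnatr_eq0.
Qed.

(** * J-self-adjoint operators *)

Section LinearRelation.
Variables (R : realType) (H : lmodType R[i]) (S : lrel H).
Hypothesis Slin : linear_rel S.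

Lemma linrelD p q : S p -> S q -> S (p + q).
Proof. by move=> Sp Sq; have := Slin.2 1 p q Sp Sq; rewrite !scale1r. Qed.

Lemma linrelZ a p : S p -> S (a *: p).
Proof. by move=> Sp; have := Slin.2 a p _ Sp Slin.1; rewrite !addr0. Qed.

Lemma linrelB p q : S p -> S q -> S (p - q).
Proof. by move=> Sp Sq; rewrite -scaleN1r; apply: linrelD Sp (linrelZ _ Sq). Qed.

End LinearRelation.

Section Operator.
Variables (R : realType) (H : lmodType R[i]) (ip : H -> H -> R[i]).
Variables (J : {linear H -> H}) (T : lrel H).
Hypotheses (hilb : is_hilbert ip) (JJ : forall x, J (J x) = x).
Hypothesis JC : forall x y, ip (J x) y = ip x (J y).
Hypotheses (Tlin : linear_rel T) (TJ : J_self_adjoint ip J T).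
Hypothesis dense_min : dense_in ip (fun _ => True) (dom (Tmin ip T)).

Local Notation Tmin := (Tmin ip T).
Local Notation Tmax := (adj ip Tmin).
Definition Jgraph (p : H * H) : H * H := (J p.1, J p.2).

Lemma adjP (S : lrel H) p : adj ip S p <-> forall q, S q -> ip q.2 p.1 = ip q.1 p.2.
Proof. by split=> [[]|]. Qed.

Lemma adj_linear (S : lrel H) : linear_rel (adj ip S).
Proof.
split; first by apply/adjP => q _; rewrite !(ipE hilb).
move=> a p q /adjP hp /adjP hq; apply/adjP => r Sr.
by rewrite !(ipE hilb) hp // hq.
Qed.

(** Self-adjointness of [J T] read on [T]: left to right [T] is isotropic for the form
    [ip (J q.2) p.1 - ip (J q.1) p.2], right to left it is maximal. *)
Lemma J_self_adjoint_maximal p :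
  T p <-> forall q, T q -> ip (J q.2) p.1 = ip (J q.1) p.2.
Proof.
have TJrel q : T q <-> Jrel J T (q.1, J q.2).
  by case: q => q1 q2; split=> [Tq|[g /= [Tg /(can_inj JJ)->]]] //; exists q2.
rewrite TJrel TJ.2 adjP; split=> h q Tq.
  rewrite (h (q.1, J q.2)) /= ?JC //; exact: (TJrel q).1.
by case: q Tq => q1 _ [g /= [Tg ->]]; rewrite (h (q1, g)) //= JC.
Qed.

Lemma adj_T p : adj ip T p <-> T (Jgraph p).
Proof.
by rewrite adjP J_self_adjoint_maximal; split=> h q /h; rewrite /= -?JC !JJ ?JC // !JC !JJ.
Qed.

Lemma TminP p : Tmin p <-> T p /\ T (Jgraph p).
Proof. by rewrite /Defs.Tmin /rel_inter adj_T. Qed.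

Lemma JgraphK p : Jgraph (Jgraph p) = p.
Proof. by case: p => x y; rewrite /Jgraph /= !JJ. Qed.

Lemma Tmin_J p : Tmin p -> Tmin (Jgraph p).
Proof. by rewrite !TminP JgraphK => -[]. Qed.

Lemma Tmin_linear : linear_rel Tmin.
Proof.
split; first by split; [exact: Tlin.1 | exact: (adj_linear T).1].
move=> a p q [Tp ap] [Tq aq].
by split; [exact: Tlin.2 | exact: (adj_linear T).2].
Qed.

Lemma Tmax_linear : linear_rel Tmax.
Proof. exact: adj_linear. Qed.

Lemma Tmax_J p : Tmax p -> Tmax (Jgraph p).
Proof.
move=> /adjP h; apply/adjP => q /Tmin_J /h /=.
by rewrite !JC.
Qed.

Lemma T_Tmax p : T p -> Tmax p.
Proof.
move=> Tp; apply/adjP => q [_ /adjP/(_ p Tp)] e.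
by rewrite (ipC hilb p.1) (ipC hilb p.2) e.
Qed.

Lemma Tmin_Tmax p : Tmin p -> Tmax p.
Proof. by case=> /T_Tmax. Qed.

(** Two values at [f] differ by a vector orthogonal to [dom Tmin]; density of that domain enters
    here. *)
Lemma Tmax_single_valued : single_valued Tmax.
Proof.
move=> f g g' /adjP hg /adjP hg'; apply/eqP; rewrite -subr_eq0; apply/eqP.
have orth0 x : dom Tmin x -> ip x (g - g') = 0.
  move=> [y Txy]; have /= := hg _ Txy; rewrite (hg' _ Txy) /= => e.
  by rewrite !(ipE hilb) e subrr.
apply: (ip_eq0 hilb); apply: (ip_eq0_rip) => // a.
apply: (sqr_le_small (rip_ge0 hilb (g - g'))) => d d0.
have [|y [/orth0 y0 [_]]] := @dense_min (a *: (g - g')) I (Num.sqrt d).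
  by rewrite sqrtr_gt0.
rewrite hnorm_lt ?sqrtr_gt0 // sqr_sqrtr; last exact: ltW.
move=> lt_d; have -> : rip ip (a *: (g - g')) (g - g') = rip ip (a *: (g - g') - y) (g - g').
  by rewrite (ripDl hilb (_ *: _)) (ripNl hilb) [rip _ y _]/(complex.Re _) y0 oppr0 addr0.
apply: le_trans (rip_cauchy_schwarz hilb _ _) _.
by rewrite ler_wpM2r ?(rip_ge0 hilb) // ltW.
Qed.

Lemma Tmax_eq p q : Tmax p -> Tmax q -> p.1 = q.1 -> p = q.
Proof.
by case: p q => [f g] [f' g'] hp hq /= e; rewrite -e in hq *; rewrite (Tmax_single_valued hp hq).
Qed.

(** [Tmin] lies in the radical of the form, which therefore descends to [Tmax] modulo [Tmin]. *)
Lemma Tmax_form_min p q : Tmin p -> Tmax q -> ip (J p.2) q.1 = ip (J p.1) q.2.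
Proof. by move=> /Tmin_J hp /adjP/(_ _ hp). Qed.

(** * Reduction by the eigenspaces of [J] *)

Section Eigenspace.
Variable s : R[i].
Hypotheses (ss : s * s = 1) (sC : s^* = s).

(** The sign is a scalar, [1] for H_+ and [-1] for H_-, so that both halves share the same
    lemmas. *)
Definition eig (a : R[i]) (f : H) : Prop := J f = a *: f.
Definition proj (a : R[i]) (f : H) : H := 2^-1 *: (f + a *: J f).
Definition proj_graph (a : R[i]) (p : H * H) := (proj a p.1, proj a p.2).

Lemma eig_lin a b f g : eig a f -> eig a g -> eig a (b *: f + g).
Proof. by rewrite /eig linearP => -> ->; rewrite scalerDr !scalerA mulrC. Qed.

Lemma eig_proj f : eig s (proj s f).
Proof.
rewrite /eig /proj linearZ /= linearD linearZ /= JJ [RHS]scalerA mulrC -scalerA.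
by congr (_ *: _); rewrite scalerDr scalerA ss scale1r addrC.
Qed.

Lemma proj_eig f : eig s f -> proj s f = f.
Proof. by rewrite /proj => ->; rewrite scalerA ss scale1r half_double. Qed.

Lemma projN_eig f : eig s f -> proj (- s) f = 0.
Proof. by rewrite /proj => ->; rewrite scalerA mulNr ss scaleN1r subrr scaler0. Qed.

Lemma proj_lin a b f g : proj a (b *: f + g) = b *: proj a f + proj a g.
Proof.
rewrite /proj linearP !scalerDr !scalerA addrACA; congr (_ + _ + (_ + _)).
- by rewrite mulrC.
- by congr (_ *: _); ring.
Qed.

Lemma projD_N f : proj s f + proj (- s) f = f.
Proof. by rewrite /proj -scalerDr addrACA -scalerDl subrr scale0r addr0 half_double. Qed.

Lemma proj_graphP (S : lrel H) a p : linear_rel S -> (forall q, S q -> S (Jgraph q)) ->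
  S p -> S (proj_graph a p).
Proof.
move=> Slin SJ Sp.
exact: (linrelZ Slin 2^-1 (linrelD Slin Sp (linrelZ Slin a (SJ _ Sp)))).
Qed.

Lemma ip_proj f g : eig s g -> ip (proj s f) g = ip f g.
Proof.
move=> eg; rewrite /proj !(ipE hilb) JC eg !(ipE hilb) sC mulrA ss mul1r.
by field.
Qed.

Lemma ip_proj_proj f g : ip (proj s f) (proj s g) = ip f (proj s g).
Proof. exact/ip_proj/eig_proj. Qed.

Lemma ip_proj_projJ f g : ip (proj s f) (proj s g) = 2^-1 * (ip f g + s * ip (J f) g).
Proof.
by rewrite (ipC hilb) ip_proj_proj -(ipC hilb) /proj (ipZl hilb) (ipDl hilb) (ipZl hilb).
Qed.

(** [Jgraph p] and [s *: p] both lie in [Tmax] and have the same first component. *)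
Lemma Tmax_eig p : Tmax p -> eig s p.1 -> eig s p.2.
Proof.
move=> hp ep; have := Tmax_eq (Tmax_J hp) (linrelZ Tmax_linear s hp) ep.
by case.
Qed.

(** Over [eig s] one has [Jgraph p = s *: p], so [p] is in [T^* = J T J] as well. *)
Lemma T_eig_Tmin p : T p -> eig s p.1 -> Tmin p.
Proof.
move=> Tp e1; apply/TminP; split=> //; have e2 := Tmax_eig (T_Tmax Tp) e1.
by rewrite /Jgraph e1 e2; exact: (linrelZ Tlin s Tp).
Qed.

Definition Tmin_eig : lrel H := fun p => Tmin p /\ eig s p.1.

(** Pairing with vectors of [eig s] sees only the projection of a test element, and projecting keeps
    it in [Tmin]; so the adjoint inside [eig s] is a restriction of [Tmax]. *)
Lemma Tmax_eigP p : adj_in ip (eig s) Tmin_eig p <-> Tmax p /\ eig s p.1.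
Proof.
split=> [[e1 e2 h]|[hp e1]]; last first.
  by split=> [//||q [/((adjP _ _).1 hp)//]]; exact: Tmax_eig.
split=> //; apply/adjP => q Tq.
have := h (proj_graph s q); rewrite /= !ip_proj //; apply.
by split; [exact: proj_graphP Tmin_linear Tmin_J Tq | exact: eig_proj].
Qed.

End Eigenspace.

(** * Von Neumann's formula and coordinates on [Tmax] modulo [Tmin] *)

Lemma Tmin_orth : exists X, forall p, Tmin p <-> orth (ip2 ip) X p.
Proof.
(* Rotated graphs: orthogonality to the first family is membership in [T^*], to the second
   membership in [T]. *)
exists (fun y => exists2 q, T q & y = (q.2, - q.1) \/ y = (J q.2, - J q.1)) => p.
split=> [[Tp /adjP ap] _ [q Tq [->|->]]|h].
- by rewrite /ip2 /= (ipE hilb) ap // subrr.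
- by rewrite /ip2 /= (ipE hilb) ((J_self_adjoint_maximal p).1 Tp) // subrr.
split; [apply/J_self_adjoint_maximal|apply/adjP] => q Tq; apply/eqP; rewrite -subr_eq0; apply/eqP.
  by rewrite -(h (J q.2, - J q.1)) /ip2 /= ?(ipE hilb) //; exists q => //; right.
by rewrite -(h (q.2, - q.1)) /ip2 /= ?(ipE hilb) //; exists q => //; left.
Qed.

Lemma sqri : 'i * 'i = -1 :> R[i].
Proof. by rewrite -expr2 sqrCi. Qed.

Lemma von_neumann p : Tmax p -> exists r u v,
  [/\ Tmin r, Tmax (u, 'i *: u), Tmax (v, - 'i *: v) & p = r + (u, 'i *: u) + (v, - 'i *: v)].
Proof.
move=> hp; have [X XP] := Tmin_orth.
have [r [/XP hr orth_r]] := orth_projection (is_hilbert_ip2 hilb) X p.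
have ht : Tmax (p - r) by exact: (linrelB Tmax_linear hp (Tmin_Tmax hr)).
have -> : p = r + (p - r) by rewrite addrC subrK.
move: (p - r) orth_r ht => t orth_r ht {p hp}.
(* Orthogonality of [t] to the graph of [Tmin] is exactly the adjoint condition for the rotated
   pair. *)
have ht' : Tmax (t.2, - t.1).
  apply/adjP => q /XP/orth_r; rewrite /ip2 addrC => /eqP; rewrite addr_eq0 => /eqP ->.
  by rewrite /= (ipNr hilb).
set t' := (t.2, - t.1) in ht'.
(* The rotation [(x, y) -> (y, - x)] squares to -1; [u] and [v] give the components of [t] for its
   eigenvalues ['i] and [- 'i]. *)
pose u := 2^-1 *: (t.1 - 'i *: t.2); pose v := 2^-1 *: (t.1 + 'i *: t.2).
have eu : (u, 'i *: u) = 2^-1 *: (t - 'i *: t').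
  congr (_, _); rewrite /u scalerA mulrC -scalerA; congr (_ *: _) => /=.
  by rewrite scalerBr scalerA sqri scaleN1r opprK scalerN opprK addrC.
have ev : (v, - 'i *: v) = 2^-1 *: (t + 'i *: t').
  congr (_, _); rewrite /v scalerA mulrC -scalerA; congr (_ *: _) => /=.
  by rewrite scalerDr scalerA mulNr sqri opprK scale1r scaleNr scalerN addrC.
exists r, u, v; split=> //.
- rewrite eu; apply: (linrelZ Tmax_linear).
  exact: (linrelB Tmax_linear ht (linrelZ Tmax_linear 'i ht')).
- rewrite ev; apply: (linrelZ Tmax_linear).
  exact: (linrelD Tmax_linear ht (linrelZ Tmax_linear 'i ht')).
by rewrite eu ev -addrA -scalerDr addrACA addNr addr0 half_double.
Qed.

Lemma two_i_neq0 : ('i : R[i]) + 'i != 0.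
Proof. by rewrite -mulr2n mulrn_eq0 neq0Ci. Qed.

(** Pairing [r = (u, 'i *: u) + (v, - 'i *: v)] with either summand cancels the cross terms and
    leaves [2i] times a squared norm equal to 0. *)
Lemma defect_min_disjoint r u v :
  Tmin r -> Tmax (u, 'i *: u) -> Tmax (v, - 'i *: v) -> r.1 = u + v -> u = 0 /\ v = 0.
Proof.
move=> Tr hu hv e1.
have := Tmax_eq (Tmin_Tmax Tr) (linrelD Tmax_linear hu hv) e1 => er.
have /= := (adjP _ _).1 hu _ Tr; have /= := (adjP _ _).1 hv _ Tr.
rewrite er /= !(ipE hilb) !rmorphN /= conjCi !opprK => ev eu.
split; apply: (ip_eq0 hilb).
- apply: (mulfI two_i_neq0); rewrite mulr0; move/eqP: eu; rewrite -subr_eq0 => /eqP <-.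
  by ring.
- apply: (mulfI two_i_neq0); rewrite mulr0; move/esym/eqP: ev; rewrite -subr_eq0 => /eqP <-.
  by ring.
Qed.

(** Here [J T h = c h] with [c] imaginary and nonzero, which the symmetry of [J T] excludes unless
    [h = 0]. *)
Lemma T_J_eigenvector c h : c^* = - c -> c != 0 -> T (h, c *: J h) -> h = 0.
Proof.
move=> cC c0 Th; apply: (ip_eq0 hilb).
have := (J_self_adjoint_maximal _).1 Th _ Th; rewrite /= linearZ /= JJ !(ipE hilb) JC JJ cC.
move/eqP; rewrite -subr_eq0 mulNr opprK -mulr2n mulrn_eq0 /= mulf_eq0 (negPf c0) /=.
by move/eqP.
Qed.

Lemma linrel_sum (S : lrel H) n (c : 'I_n -> R[i]) (e t : 'I_n -> H) : linear_rel S ->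
  (forall j, S (e j, t j)) -> S (\sum_j c j *: e j, \sum_j c j *: t j).
Proof.
move=> Slin Set'; elim/big_ind2: _ => [|x y z w Sxy Szw|j _]; first exact: Slin.1.
  exact: (linrelD Slin Sxy Szw).
exact: (linrelZ Slin (c j) (Set' j)).
Qed.

Local Notation defect c := (fun h : H => Tmax (h, c *: h)).

(** Row vectors parametrize [Tmax] modulo [Tmin]: the left half holds coordinates in N_i, the right
    half in N_{-i}; [f] yields the vector and [g] its image under [Tmax]. *)
Lemma defect_coordinates m : has_dim (defect 'i) m -> has_dim (defect (- 'i)) m ->
  exists f g : {linear 'rV[R[i]]_(m + m) -> H},
  [/\ forall x, Tmax (f x, g x),
      forall r x, Tmin r -> r.1 = f x -> x = 0,
      forall p, Tmax p -> exists r x, Tmin r /\ p = r + (f x, g x),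
      forall h, Tmax (h, 'i *: h) -> exists x, h = f x &
      forall h, Tmax (h, - 'i *: h) -> exists x, h = f x].
Proof.
move=> [v [Pv free_v span_v]] [w [Pw free_w span_w]].
pose f : {linear 'rV_(m + m) -> H} := lincomb (fun j => match split j with
  inl i => v i | inr i => w i end).
pose g : {linear 'rV_(m + m) -> H} := lincomb (fun j => match split j with
  inl i => 'i *: v i | inr i => - 'i *: w i end).
have lincombZ c (e : 'I_m -> H) x : lincomb (fun j => c *: e j) x = c *: lincomb e x.
  by rewrite /lincomb scaler_sumr; apply: eq_bigr => j _; rewrite !scalerA mulrC.
have fE x y : f (row_mx x y) = lincomb v x + lincomb w y by apply: lincomb_row_mx.
have gE x y : g (row_mx x y) = 'i *: lincomb v x + - 'i *: lincomb w y.
  by rewrite -!lincombZ; apply: lincomb_row_mx.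
have hv x : Tmax (lincomb v x, 'i *: lincomb v x).
  by rewrite -lincombZ; apply: (linrel_sum _ Tmax_linear).
have hw x : Tmax (lincomb w x, - 'i *: lincomb w x).
  by rewrite -lincombZ; apply: (linrel_sum _ Tmax_linear).
have span_row n (e : 'I_n -> H) (c : 'I_n -> R[i]) :
    \sum_j c j *: e j = lincomb e (\row_j c j).
  by apply: eq_bigr => j _; rewrite mxE.
exists f, g; split.
- by move=> x; rewrite -[x]hsubmxK fE gE; exact: (linrelD Tmax_linear (hv _) (hw _)).
- move=> r x Tr; rewrite -[x]hsubmxK fE.
  move=> /(defect_min_disjoint Tr (hv _) (hw _))[/free_v v0 /free_w w0].
  have -> : lsubmx x = 0 by apply/rowP => j; rewrite v0 mxE.
  have -> : rsubmx x = 0 by apply/rowP => j; rewrite w0 mxE.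
  by rewrite row_mx0.
- move=> p /von_neumann[r [x [y [Tr /span_v[a ea] /span_w[b eb] ->]]]].
  exists r, (row_mx (\row_j a j) (\row_j b j)); split=> //.
  by rewrite fE gE -!span_row -ea -eb -addrA.
- move=> h /span_v[a ->]; exists (row_mx (\row_j a j) 0).
  by rewrite fE linear0 addr0 span_row.
- move=> h /span_w[a ->]; exists (row_mx 0 (\row_j a j)).
  by rewrite fE linear0 add0r span_row.
Qed.

(** * Deficiency indices *)

Section Coordinates.
Variables (m : nat) (f g : {linear 'rV[R[i]]_(m + m) -> H}).
Hypothesis dim_i : has_dim (defect 'i) m.
Hypothesis dim_Ni : has_dim (defect (- 'i)) m.
Hypothesis fg_max : forall x, Tmax (f x, g x).
Hypothesis f_min : forall r x, Tmin r -> r.1 = f x -> x = 0.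
Hypothesis fg_span : forall p, Tmax p -> exists r x, Tmin r /\ p = r + (f x, g x).
Hypothesis f_i : forall h, Tmax (h, 'i *: h) -> exists x, h = f x.
Hypothesis f_Ni : forall h, Tmax (h, - 'i *: h) -> exists x, h = f x.

Lemma fgD a x y : (f (a *: x + y), g (a *: x + y)) = a *: (f x, g x) + (f y, g y).
Proof. by rewrite !linearP. Qed.

Lemma f_inj x : f x = 0 -> x = 0.
Proof. by move=> fx; apply: (f_min Tmin_linear.1). Qed.

(** The row space of [L] is the image of [T] in [Tmax] modulo [Tmin]; nothing is lost, since [Tmin]
    is contained in [T]. *)
Lemma domain_mx : exists L : 'M[R[i]]_(m + m), forall x, T (f x, g x) <-> (x <= L)%MS.
Proof.
apply: subspace_mx => [|a x y Tx Ty]; first by rewrite !linear0; exact: Tlin.1.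
by rewrite fgD; exact: (linrelD Tlin (linrelZ Tlin a Tx) Ty).
Qed.

Section Rank.
Variable L : 'M[R[i]]_(m + m).
Hypothesis domL : forall x, T (f x, g x) <-> (x <= L)%MS.

(* [L] contains its own orthogonal complement for the form
   <J p.2, q.1> - <J p.1, q.2>, whose dimension is at least [2m - rank L]. *)
Lemma leq_mxrank_domain : (m <= \rank L)%N.
Proof.
pose B := row_base L.
(* The form paired with a basis of [L]: the kernel of [Phi] is the orthogonal complement of [L]. *)
pose Phi (x : 'rV[R[i]]_(m + m)) : 'rV[R[i]]_(\rank L) :=
  \row_k (ip (J (g x)) (f (row k B)) - ip (J (f x)) (g (row k B))).
have PhiP : linear Phi.
  by move=> a x y; apply/rowP => k; rewrite !mxE !linearP !(ipE hilb); ring.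
pose PhiL : {linear 'rV[R[i]]_(m + m) -> 'rV[R[i]]_(\rank L)} :=
  HB.pack Phi (GRing.isLinear.Build _ _ _ _ Phi PhiP).
pose M := lin1_mx PhiL.
have : (kermx M <= L)%MS.
  apply/row_subP => i; move: (row i _) (row_sub i (kermx M)) => x.
  rewrite sub_kermx mul_rV_lin1 => /eqP Phi0; apply/domL/J_self_adjoint_maximal => q Tq.
  have [r [y [Tr eq_q]]] := fg_span (T_Tmax Tq).
  have : T (f y, g y).
    have -> : (f y, g y) = q - r by rewrite eq_q addrC addKr.
    exact: (linrelB Tlin Tq Tr.1).
  move/domL; rewrite -(eq_row_base L) => /submxP[c ey].
  (* The pairs orthogonal to [(f x, g x)] form a linear relation, so it suffices to check [Tmin] and
     the basis rows of [L]. *)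
  pose Z : lrel H := fun q => ip (J q.2) (f x) = ip (J q.1) (g x).
  have Zlin : linear_rel Z.
    split; first by rewrite /Z /= !linear0 !(ip0l hilb).
    by move=> a p1 p2 e1 e2; rewrite /Z /= !linearP !(ipE hilb) e1 e2.
  suff Zy : Z (f y, g y).
    by rewrite eq_q; exact: (linrelD Zlin (Tmax_form_min Tr (fg_max x)) Zy).
  rewrite ey !linear_mulmx; apply: (linrel_sum _ Zlin) => k; rewrite /Z /=.
  move/rowP: Phi0 => /(_ k); rewrite !mxE => /eqP; rewrite subr_eq0 => /eqP e.
  by rewrite !JC (ipC hilb (J (f x))) (ipC hilb (J (g x))) e.
move=> /mxrankS; rewrite mxrank_ker; have := rank_leq_col M; lia.
Qed.

Section Eigen.
Variables (s s' : R[i]) (U V : 'M[R[i]]_(m + m)).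
Hypotheses (s1 : s = 1 \/ s = -1) (s1' : s' = 1 \/ s' = -1).
Hypothesis UP : forall x, (Tmax (f x, 'i *: f x) /\ eig s (f x)) <-> (x <= U)%MS.
Hypothesis VP : forall x, (Tmax (f x, - 'i *: f x) /\ eig s' (f x)) <-> (x <= V)%MS.

Lemma mxrank_eigen_domain :
  \rank (U + V + L)%MS = (\rank U + \rank V + \rank L)%N.
Proof.
apply: mxrank_direct3 => y z /UP[hy ey] /VP[hz ez] /domL Tyz.
have ef : f (y + z) = f y + f z by rewrite linearD.
have gE : g (y + z) = 'i *: f y + - 'i *: f z.
  have := Tmax_eq (fg_max (y + z)) (linrelD Tmax_linear hy hz) ef.
  by case.
suff [r Tr er] : exists2 r, Tmin r & r.1 = f y + f z.
  have [fy fz] := defect_min_disjoint Tr hy hz er.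
  by split; apply: f_inj.
(* Equal signs put the sum in one eigenspace, where [T] reduces to [Tmin]; opposite signs give
   [T h = 'i * s *: J h]. *)
have [es|es] : s' = s \/ s' = - s.
  by case: s1 => ->; case: s1' => ->; rewrite ?opprK; [left|right|right|left].
  exists (f (y + z), g (y + z)); last by [].
  apply: (@T_eig_Tmin s) => //=; rewrite ef -[f y]scale1r; apply: eig_lin => //.
  by rewrite -es.
suff -> : f y + f z = 0 by exists 0 => //; exact: Tmin_linear.1.
have ss : s * s = 1 by case: s1 => ->; rewrite ?mulrNN mulr1.
rewrite -ef; apply: (@T_J_eigenvector ('i * s)).
- by rewrite rmorphM /= conjCi; case: s1 => ->; rewrite ?rmorphN /= rmorph1 mulNr.
- by case: s1 => ->; rewrite ?mulrN mulr1 ?oppr_eq0 neq0Ci.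
have -> : ('i * s) *: J (f (y + z)) = g (y + z); last by [].
by rewrite gE ef linearD /= ey ez es scalerDr !scalerA mulrN -mulrA ss mulr1.
Qed.

End Eigen.
End Rank.

Lemma defect_eig_mx c s : exists U : 'M[R[i]]_(m + m),
  forall x, (Tmax (f x, c *: f x) /\ eig s (f x)) <-> (x <= U)%MS.
Proof.
apply: subspace_mx => [|a x y [hx ex] [hy ey]].
  by rewrite linear0 scaler0 /eig linear0 scaler0; split=> //; exact: Tmax_linear.1.
split; last by rewrite linearP; exact: eig_lin.
have -> : (f (a *: x + y), c *: f (a *: x + y)) = a *: (f x, c *: f x) + (f y, c *: f y).
  by rewrite linearP scalerDr !scalerA [c * a]mulrC -scalerA.
exact: (linrelD Tmax_linear (linrelZ Tmax_linear a hx) hy).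
Qed.

(** The defect space is [J]-invariant, so each of its vectors is the sum of its two projections,
    which lie in it again. *)
Lemma mxrank_defect_le c (U V : 'M[R[i]]_(m + m)) :
  has_dim (defect c) m -> (forall h, Tmax (h, c *: h) -> exists x, h = f x) ->
  (forall x, (Tmax (f x, c *: f x) /\ eig 1 (f x)) <-> (x <= U)%MS) ->
  (forall x, (Tmax (f x, c *: f x) /\ eig (-1) (f x)) <-> (x <= V)%MS) ->
  (m <= \rank U + \rank V)%N.
Proof.
move=> dimc surj UP VP.
have [W WP] : exists W : 'M[R[i]]_(m + m), forall x, Tmax (f x, c *: f x) <-> (x <= W)%MS.
  apply: subspace_mx => [|a x y hx hy].
    by rewrite linear0 scaler0; exact: Tmax_linear.1.
  have -> : (f (a *: x + y), c *: f (a *: x + y)) = a *: (f x, c *: f x) + (f y, c *: f y).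
    by rewrite linearP scalerDr !scalerA [c * a]mulrC -scalerA.
  exact: (linrelD Tmax_linear (linrelZ Tmax_linear a hx) hy).
rewrite -[leqLHS](mxrank_has_dim f_inj surj WP dimc).
apply: leq_trans (mxrank_adds_leqif U V).1.
apply/mxrankS/row_subP => k; move: (row k W) (row_sub k W) => x /WP hx.
have ss : 1 * 1 = 1 :> R[i] by rewrite mulr1.
have ssN : (-1) * (-1) = 1 :> R[i] by rewrite mulrNN mulr1.
have hp s : Tmax (proj s (f x), c *: proj s (f x)).
  have := proj_graphP s Tmax_linear Tmax_J hx.
  rewrite /proj_graph /= {2}/proj linearZ /= scalerA [s * c]mulrC -scalerA -scalerDr.
  by rewrite scalerA mulrC -scalerA.
have [y ey] := surj _ (hp 1); have [z ez] := surj _ (hp (-1)).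
have -> : x = y + z.
  apply/eqP; rewrite -subr_eq0; apply/eqP/f_inj.
  by rewrite linearB linearD /= -ey -ez projD_N // subrr.
apply/sub_addsmxP; rewrite /=.
have /submxP[a ->] : (y <= U)%MS by apply/UP; rewrite -ey; split=> //; exact: eig_proj.
have /submxP[b ->] : (z <= V)%MS by apply/VP; rewrite -ez; split=> //; exact: eig_proj.
by exists (a, b).
Qed.

(** With [m <= \rank L], directness gives [\rank A + \rank B <= m] for each of the four choices of
    signs. Since the two [A] ranks, and likewise the two [B] ranks, add up to at least [m], all four
    ranks equal [m / 2]. *)
Lemma defect_eig_ranks : exists k, m = k.*2 /\ forall c s, (c = 'i \/ c = - 'i) ->
  (s = 1 \/ s = -1) -> has_dim (fun h => Tmax (h, c *: h) /\ eig s h) k.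
Proof.
have [L domL] := domain_mx; have rL := leq_mxrank_domain domL.
have [A1 A1P] := defect_eig_mx 'i 1; have [A2 A2P] := defect_eig_mx 'i (-1).
have [B1 B1P] := defect_eig_mx (- 'i) 1; have [B2 B2P] := defect_eig_mx (- 'i) (-1).
have rA := mxrank_defect_le dim_i f_i A1P A2P.
have rB := mxrank_defect_le dim_Ni f_Ni B1P B2P.
have s1 : (1 : R[i]) = 1 \/ (1 : R[i]) = -1 by left.
have s2 : (-1 : R[i]) = 1 \/ (-1 : R[i]) = -1 by right.
have r11 := mxrank_eigen_domain domL s1 s1 A1P B1P.
have r12 := mxrank_eigen_domain domL s1 s2 A1P B2P.
have r21 := mxrank_eigen_domain domL s2 s1 A2P B1P.
have r22 := mxrank_eigen_domain domL s2 s2 A2P B2P.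
have l11 := rank_leq_row (A1 + B1 + L)%MS; have l12 := rank_leq_row (A1 + B2 + L)%MS.
have l21 := rank_leq_row (A2 + B1 + L)%MS; have l22 := rank_leq_row (A2 + B2 + L)%MS.
exists (\rank A1); split; first lia.
move=> c s [->|->] [->|->].
- by apply: (has_dim_mxrank f_inj _ A1P) => h [/f_i].
- have -> : \rank A1 = \rank A2 by lia.
  by apply: (has_dim_mxrank f_inj _ A2P) => h [/f_i].
- have -> : \rank A1 = \rank B1 by lia.
  by apply: (has_dim_mxrank f_inj _ B1P) => h [/f_Ni].
have -> : \rank A1 = \rank B2 by lia.
by apply: (has_dim_mxrank f_inj _ B2P) => h [/f_Ni].
Qed.

(** The defect parts over [eig s] together with [L] now fill all [2m] dimensions, and [proj (- s)]
    kills those defect parts. *)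
Lemma proj_domain_surj s q : s = 1 \/ s = -1 -> Tmax q ->
  exists2 p, T p & proj (- s) p.1 = proj (- s) q.1.
Proof.
move=> s1 hq; have ss : s * s = 1 by case: s1 => ->; rewrite ?mulrNN mulr1.
have [L domL] := domain_mx; have rL := leq_mxrank_domain domL.
have [A AP] := defect_eig_mx 'i s; have [B BP] := defect_eig_mx (- 'i) s.
have [k [mk dimk]] := defect_eig_ranks.
have rA : \rank A = k.
  by apply: (mxrank_has_dim f_inj _ AP (dimk 'i s _ s1)) => [h [/f_i]|]; last left.
have rB : \rank B = k.
  by apply: (mxrank_has_dim f_inj _ BP (dimk (- 'i) s _ s1)) => [h [/f_Ni]|]; last right.
have full : row_full (A + B + L)%MS.
  rewrite /row_full eqn_leq rank_leq_row (mxrank_eigen_domain domL s1 s1 AP BP).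
  by apply/andP; split=> //; lia.
have [r [x [Tr eq_q]]] := fg_span hq.
have /sub_addsmxP[[a l]] /= := submx_full x full.
have /sub_addsmxP[[b c] /= ->] := submxMl a (A + B)%MS.
move: (submxMl b A) (submxMl c B) (submxMl l L) => /AP[_ ey] /BP[_ ez] /domL Tl ex.
exists (r + (f (l *m L), g (l *m L))); first exact: (linrelD Tlin Tr.1 Tl).
rewrite eq_q ex /= !linearD /=.
have projD u v : proj (- s) (u + v) = proj (- s) u + proj (- s) v.
  by have := proj_lin (- s) 1 u v; rewrite !scale1r.
by rewrite !projD (projN_eig ss ey) (projN_eig ss ez) !add0r.
Qed.

End Coordinates.

Lemma cdot_add_eq0 k (x y : 'cV[R[i]]_k) : cdot x x + cdot y y = 0 -> x = 0 /\ y = 0.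
Proof.
have cdot_ge0 (z : 'cV[R[i]]_k) : 0 <= cdot z z by apply: sumr_ge0 => j _; exact: mul_conjC_ge0.
have cdot_eq0 (z : 'cV[R[i]]_k) : cdot z z = 0 -> z = 0.
  move=> /eqP; rewrite psumr_eq0 => [/allP z0|j _]; last exact: mul_conjC_ge0.
  apply/colP => j; rewrite mxE; apply/eqP; rewrite -mul_conjC_eq0.
  by apply: z0; rewrite mem_index_enum.
by move/eqP; rewrite paddr_eq0 // => /andP[/eqP/cdot_eq0-> /eqP/cdot_eq0->].
Qed.

(** * Boundary triples *)

Section Transfer.
Variables (s : R[i]) (k : nat) (G0 G1 : H -> 'cV[R[i]]_k).
Hypotheses (ss : s * s = 1) (sC : s^* = s).
Hypothesis surjN : forall q, Tmax q -> exists2 p, T p & proj (- s) p.1 = proj (- s) q.1.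
Hypothesis surj : forall q, Tmax q -> exists2 p, T p & proj s p.1 = proj s q.1.
Hypothesis triple : boundary_triple ip (eig s) (Tmin_eig s) G0 G1.

Local Notation dom_max a := (dom (adj_in ip (eig a) (Tmin_eig a))).

Lemma dom_max_proj a p : a * a = 1 -> a^* = a -> Tmax p -> dom_max a (proj a p.1).
Proof.
move=> aa aC hp; exists (proj a p.2); apply/Tmax_eigP => //; split; last exact: eig_proj.
exact: (proj_graphP a Tmax_linear Tmax_J hp).
Qed.

Lemma boundary_lin a f g : dom_max s f -> dom_max s g ->
  G0 (a *: f + g) = a *: G0 f + G0 g /\ G1 (a *: f + g) = a *: G1 f + G1 g.
Proof. by case: triple => + _ _; apply. Qed.

Lemma boundary_min r : Tmin r -> eig s r.1 -> G0 r.1 = 0 /\ G1 r.1 = 0.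
Proof.
move=> Tr er; have [_ green onto] := triple.
have hr : adj_in ip (eig s) (Tmin_eig s) r by apply/Tmax_eigP => //; split=> //; exact: Tmin_Tmax.
(* These boundary values turn the right side of Green's identity into a sum of two squared norms,
   while the left side vanishes because [r] is in [Tmin]. *)
have [f [[f' hf] f0 f1]] := onto (G1 r.1) (- G0 r.1).
have := green _ _ hr hf; rewrite /= f0 f1.
have [_ _ ->] := hf; last by [].
rewrite subrr => /esym/eqP; rewrite subr_eq0 => /eqP e.
suff /cdot_add_eq0[-> ->] : cdot (G1 r.1) (G1 r.1) + cdot (G0 r.1) (G0 r.1) = 0 by [].
rewrite e -[X in _ + X]opprK -[X in _ - X]sumrN -[X in X - _]/(\sum_j _).
apply/eqP; rewrite subr_eq0; apply/eqP/eq_bigr => j _.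
by rewrite mxE rmorphN mulrN.
Qed.

(** By Green's identity [r] is orthogonal, for the form, to the [s]-part of every element of [T],
    and [r] sees only that part; maximality of [T] concludes. *)
Lemma boundary_kernel r : Tmax r -> eig s r.1 -> G0 r.1 = 0 -> G1 r.1 = 0 -> T r.
Proof.
move=> hr er r0 r1; apply/J_self_adjoint_maximal => q Tq; have [_ green _] := triple.
have hrs : adj_in ip (eig s) (Tmin_eig s) r by apply/Tmax_eigP.
have hqs : adj_in ip (eig s) (Tmin_eig s) (proj_graph s q).
  apply/Tmax_eigP => //; split; last exact: eig_proj.
  exact: (proj_graphP s Tmax_linear Tmax_J (T_Tmax Tq)).
have er2 := Tmax_eig hr er.
have := green _ _ hqs hrs; rewrite r0 r1 /= !ip_proj // /cdot !big1 ?subrr; last first.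
- by move=> j _; rewrite mxE rmorph0 mulr0.
- by move=> j _; rewrite mxE rmorph0 mulr0.
by move/eqP; rewrite subr_eq0 !JC er er2 !(ipE hilb) => /eqP->.
Qed.

(** This makes the transferred maps independent of the chosen lift: [p - q] lies over [eig s], hence
    in [Tmin], where the boundary values vanish. *)
Lemma boundary_eq p q : T p -> T q -> proj (- s) p.1 = proj (- s) q.1 ->
  G0 (proj s p.1) = G0 (proj s q.1) /\ G1 (proj s p.1) = G1 (proj s q.1).
Proof.
move=> Tp Tq e; have Td := linrelB Tlin Tp Tq.
have ed : eig s (p - q).1.
  have en : proj (- s) (p - q).1 = 0 by rewrite /= addrC -(scaleN1r q.1) proj_lin e scaleN1r addNr.
  by rewrite -[(p - q).1](projD_N s) en addr0; exact: eig_proj.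
have [d0 d1] := boundary_min (T_eig_Tmin Td ed) ed.
have [e0 e1] := boundary_lin 1 (dom_max_proj ss sC (T_Tmax Td)) (dom_max_proj ss sC (T_Tmax Tq)).
have ep : proj s p.1 = 1 *: proj s (p - q).1 + proj s q.1.
  by rewrite -proj_lin scale1r subrK.
by rewrite ep e0 e1 (proj_eig ss ed) d0 d1 !scaler0 !add0r.
Qed.

Lemma boundary_transfer : exists F0 F1 : H -> 'cV[R[i]]_k,
  boundary_triple ip (eig (- s)) (Tmin_eig (- s)) F0 F1 /\
  forall h, dom T h <->
    [/\ exists f g, [/\ dom_max s f, dom_max (- s) g & h = f + g],
        G0 (proj s h) = F0 (proj (- s) h) & G1 (proj s h) = F1 (proj (- s) h)].
Proof.
have ssN : (- s) * (- s) = 1 by rewrite mulrNN.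
have sCN : (- s)^* = - s by rewrite rmorphN /= sC.
(* Outside the domain the lift is an arbitrary default. *)
have /choice[lift liftP] g : exists p, dom_max (- s) g -> T p /\ proj (- s) p.1 = g.
  have [hg|] := pselect (dom_max (- s) g); last by exists 0.
  have [g' /(Tmax_eigP ssN sCN)[hmax eg]] := hg.
  have [p Tp ep] := surjN hmax.
  by exists p => _; rewrite ep proj_eig.
pose F (G : H -> 'cV[R[i]]_k) g := G (proj s (lift g).1).
have FE p : T p -> F G0 (proj (- s) p.1) = G0 (proj s p.1) /\
                   F G1 (proj (- s) p.1) = G1 (proj s p.1).
  move=> Tp; have [Tl el] := liftP _ (dom_max_proj ssN sCN (T_Tmax Tp)).
  exact: boundary_eq.
have dom_maxN g : dom_max (- s) g -> exists2 p, T p & g = proj (- s) p.1.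
  by move=> /liftP[Tl <-]; exists (lift g).
exists (F G0), (F G1); split; first split.
- move=> a _ _ /dom_maxN[p Tp ->] /dom_maxN[q Tq ->].
  have Tapq := linrelD Tlin (linrelZ Tlin a Tp) Tq.
  have [e0 e1] := FE _ Tapq; have [p0 p1] := FE _ Tp; have [q0 q1] := FE _ Tq.
  rewrite -proj_lin e0 e1 p0 p1 q0 q1 /= proj_lin.
  by apply: boundary_lin; apply: dom_max_proj => //; apply: T_Tmax.
- have lift2 p : adj_in ip (eig (- s)) (Tmin_eig (- s)) p ->
      exists2 p', T p' & p = proj_graph (- s) p'.
    move=> hp; have [|p' Tp' e] := dom_maxN p.1.
      by exists p.2; rewrite -surjective_pairing.
    exists p' => //; apply: (@Tmax_eq p (proj_graph (- s) p') _ _ e).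
      exact: ((Tmax_eigP ssN sCN p).1 hp).1.
    exact: (proj_graphP _ Tmax_linear Tmax_J (T_Tmax Tp')).
  move=> _ _ /lift2[p Tp ->] /lift2[q Tq ->].
  have [p0 p1] := FE _ Tp; have [q0 q1] := FE _ Tq.
  rewrite /= p0 p1 q0 q1; have [_ green _] := triple.
  have proj_max r : T r -> adj_in ip (eig s) (Tmin_eig s) (proj_graph s r).
    move=> Tr; apply/Tmax_eigP => //; split; last exact: eig_proj.
    exact: (proj_graphP _ Tmax_linear Tmax_J (T_Tmax Tr)).
  (* The Green expressions of the two halves differ by [s] times the form on [p] and [q], which is
     zero on [T]. *)
  rewrite -(green _ _ (proj_max _ Tp) (proj_max _ Tq)) /= !ip_proj_projJ //.
  by rewrite ((J_self_adjoint_maximal q).1 Tq p Tp) !JC -!JC; field.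
- move=> a b; have [_ _ onto] := triple; have [f [[f' hf] <- <-]] := onto a b.
  have [hmax ef] := (Tmax_eigP ss sC _).1 hf; have [p Tp] := surj hmax.
  rewrite (proj_eig ss ef) /= => <-; have [e0 e1] := FE _ Tp.
  exists (proj (- s) p.1); split=> //; exact: dom_max_proj (T_Tmax Tp).
move=> h; split=> [[h' Th]|].
  have [e0 e1] := FE _ Th; split=> //.
  exists (proj s h), (proj (- s) h); split; last by rewrite projD_N.
  - exact: (dom_max_proj ss sC (T_Tmax Th)).
  - exact: (dom_max_proj ssN sCN (T_Tmax Th)).
case=> [[f [g [[f' /(Tmax_eigP ss sC)[hf _]] [g' /(Tmax_eigP ssN sCN)[hg _]] eh]]]].
have [q hq <-] : exists2 q, Tmax q & q.1 = h.
  by exists ((f, f') + (g, g')) => //; exact: (linrelD Tmax_linear hf hg).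
(* [p] in [T] shares the [- s] part of [q]. The [s] part of [q - p] has zero boundary values, so it
   lies in [T], and adding it to [p] recovers [h]. *)
have [p Tp ep] := surjN hq; rewrite -ep; have [-> ->] := FE _ Tp => q0 q1.
have hd := linrelD Tmax_linear (linrelZ Tmax_linear (-1) (T_Tmax Tp)) hq.
have hr := proj_graphP s Tmax_linear Tmax_J hd.
have [] := boundary_lin (-1) (dom_max_proj ss sC (T_Tmax Tp)) (dom_max_proj ss sC hq).
rewrite -proj_lin q0 q1 => e0 e1.
have Tr : T (proj_graph s (-1 *: p + q)).
  apply: boundary_kernel hr (eig_proj ss _) _ _; first by rewrite e0 scaleN1r addNr.
  by rewrite e1 scaleN1r addNr.
have := linrelD Tlin Tp Tr; set r := _ + _ => Tpr.
exists r.2; suff -> : q.1 = r.1 by rewrite -surjective_pairing.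
have ep1 : p.1 = proj s p.1 + proj (- s) q.1 by rewrite -ep projD_N.
by rewrite /= proj_lin scaleN1r {1}ep1 addrACA subrr add0r addrC projD_N.
Qed.

End Transfer.

(** * Translation between signs and the notation of the statement *)

Lemma defect_plus_eig s : s * s = 1 -> s^* = s ->
  defect_plus ip (eig s) (Tmin_eig s) = fun h => Tmax (h, 'i *: h) /\ eig s h.
Proof. by move=> ss sC; apply/funext => h; apply/propext; exact: Tmax_eigP. Qed.

Lemma defect_minus_eig s : s * s = 1 -> s^* = s ->
  defect_minus ip (eig s) (Tmin_eig s) = fun h => Tmax (h, - 'i *: h) /\ eig s h.
Proof. by move=> ss sC; apply/funext => h; apply/propext; exact: Tmax_eigP. Qed.

Lemma Hplus_eig : Hplus J = eig 1.
Proof.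
apply/funext => h; apply/propext; rewrite /Hplus /eig scale1r.
by split=> [/eqP|->]; rewrite ?subrr // subr_eq0 => /eqP.
Qed.

Lemma Hminus_eig : Hminus J = eig (-1).
Proof.
apply/funext => h; apply/propext; rewrite /Hminus /eig scaleN1r.
by split=> [/eqP|->]; rewrite ?addNr // addr_eq0 => /eqP.
Qed.

Lemma Pplus_proj h : Pplus J h = proj 1 h.
Proof. by rewrite /Pplus /proj scale1r. Qed.

Lemma Pminus_proj h : Pminus J h = proj (-1) h.
Proof. by rewrite /Pminus /proj scaleN1r. Qed.

Lemma Tmin_plus_eig : Tmin_plus ip J T = Tmin_eig 1.
Proof. by rewrite /Tmin_plus Hplus_eig. Qed.

Lemma Tmin_minus_eig : Tmin_minus ip J T = Tmin_eig (-1).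
Proof. by rewrite /Tmin_minus Hminus_eig. Qed.

End Operator.

Theorem theorem2p4 (R : realType) (H : lmodType R[i]) (ip : H -> H -> R[i])
    (J : {linear H -> H}) (T : lrel H) (m : nat) :
  is_hilbert ip ->
  (forall x, J (J x) = x) ->
  (forall x y, ip (J x) y = ip x (J y)) ->
  linear_rel T -> single_valued T ->
  J_self_adjoint ip J T ->
  dense_in ip (fun _ => True) (dom (Tmin ip T)) ->
  n_plus_is ip (fun _ => True) (Tmin ip T) m ->
  n_minus_is ip (fun _ => True) (Tmin ip T) m ->
  (~~ odd m /\
   [/\ n_plus_is ip (Hplus J) (Tmin_plus ip J T) m./2,
       n_minus_is ip (Hplus J) (Tmin_plus ip J T) m./2,
       n_plus_is ip (Hminus J) (Tmin_minus ip J T) m./2 &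
       n_minus_is ip (Hminus J) (Tmin_minus ip J T) m./2])
  /\
  (forall G0p G1p : H -> 'cV[R[i]]_(m./2),
     boundary_triple ip (Hplus J) (Tmin_plus ip J T) G0p G1p ->
     exists G0m G1m : H -> 'cV[R[i]]_(m./2),
       boundary_triple ip (Hminus J) (Tmin_minus ip J T) G0m G1m /\
       forall h, dom T h <->
         [/\ Dmax ip J T h,
             G0p (Pplus J h) = G0m (Pminus J h) &
             G1p (Pplus J h) = G1m (Pminus J h)]).
Proof.
move=> hilb JJ JC Tlin Tsv TJ dense np nm.
have [f [g [fg_max f_min fg_span f_i f_Ni]]] := defect_coordinates hilb JJ JC TJ dense np nm.
have [k [mk dimk]] :=
  defect_eig_ranks hilb JJ JC Tlin TJ dense np nm fg_max f_min fg_span f_i f_Ni.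
have surj := proj_domain_surj hilb JJ JC Tlin TJ dense np nm fg_max f_min fg_span f_i f_Ni.
have one_sq : 1 * 1 = 1 :> R[i] by rewrite mulr1.
have one_conj : 1^* = 1 :> R[i] by rewrite rmorph1.
have onesN_sq : (-1) * (-1) = 1 :> R[i] by rewrite mulrNN mulr1.
have oneN_conj : (-1)^* = -1 :> R[i] by rewrite rmorphN /= rmorph1.
have mh : m./2 = k by rewrite mk doubleK.
rewrite mh Tmin_plus_eig Tmin_minus_eig Hplus_eig Hminus_eig; split.
  rewrite mk odd_double; split=> //.
  split; rewrite /n_plus_is /n_minus_is ?(defect_plus_eig hilb) ?(defect_minus_eig hilb) //;
    by apply: dimk; auto.
move=> G0 G1 triple.
have [||F0 [F1 [tripleF domF]]] :=
  boundary_transfer hilb JJ JC Tlin TJ dense one_sq one_conj _ _ triple.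
- by move=> q; apply: surj; left.
(* Surjectivity onto the H_+ side is the instance [s = -1], hence the rewriting of 1 as a double
   opposite. *)
- by move=> q hq; rewrite -[1]opprK; apply: surj => //; right.
exists F0, F1; split=> // h; rewrite Pplus_proj Pminus_proj domF /Dmax.
by rewrite /Tmax_plus /Tmax_minus Tmin_plus_eig Tmin_minus_eig Hplus_eig Hminus_eig.
Qed.
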